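(* Let $X$ be a metric space and $n\in\mathbb N$. Then: (1) $\mathcal A_n(X)$ and, for every $F\in\mathcal K(X)$, $\mathcal A_n(X,F)$ are $F_{\sigma\delta}$-sets in $\mathcal K(X)$; (2) $\mathcal A_\omega(X)$ is an $F_{\sigma\delta\sigma}$-set in $\mathcal K(X)$. If moreover $X$ is separable and $F$ is an $F_\sigma$-subset of $X$, then: (3) $\mathcal A_{=n}(F,X)$ is of type $F_{\sigma\delta}$ in $\mathcal A_{=n}(X)$; (4) $\mathcal A_{=n}(X,F)$ is of type $G_{\delta\sigma}$ in $\mathcal A_{=n}(X)$; (5) $\mathcal A_{=n}(F)$ is of type $D_2(F_{\sigma\delta})$ in $\mathcal A_{=n}(X)$; (6) $\mathcal A_n(F,X)$, $\mathcal A_n(X,F)$ and $\mathcal A_n(F)$ are of type $D_{2n}(F_{\sigma\delta})$ in $\mathcal K(X)$.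
   Context: $\mathbb N=\{1,2,\dots\}$. $\mathcal K(X)$ is the space of all nonempty compact subsets of $X$ with the Vietoris topology. For $A\in\mathcal K(X)$, $A'$ denotes the set of accumulation points of $A$. Put $\mathcal A_n(X)=\{A\in\mathcal K(X):1\le|A'|\le n\}$, $\mathcal A_{=n}(X)=\{A\in\mathcal K(X):|A'|=n\}$, $\mathcal A_\omega(X)=\{A\in\mathcal K(X):1\le|A'|<\omega\}$ (nonempty finite derived set). For $E,F\subset X$: $\mathcal A_n(E,F)=\{A\in\mathcal A_n(X): A\setminus A'\subset E,\ A'\subset F\}$ and $\mathcal A_{=n}(E,F)=\{A\in\mathcal A_{=n}(X): A\setminus A'\subset E,\ A'\subset F\}$. For $F\subset X$, $\mathcal A_n(F)$ and $\mathcal A_{=n}(F)$ are the corresponding hyperspaces of the subspace $F$ (those $A\in\mathcal A_n(X)$, resp. $\mathcal A_{=n}(X)$, with $A\subset F$). For a family $\Gamma$ of subsets of a space, $D_{2m}(\Gamma)$ is the family of sets of the form $\bigcup_{k=1}^m(A_{2k}\setminus A_{2k-1})$, where $A_1\subset A_2\subset\dots\subset A_{2m}$ are elements of $\Gamma$; a set is of type $D_{2m}(F_{\sigma\delta})$ in a space if it belongs to $D_{2m}(\Gamma)$ for $\Gamma$ the family of $F_{\sigma\delta}$-subsets of that space. *)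

(* Defs.v *)
From HB Require Import structures.
From mathcomp Require Import all_boot all_order all_algebra.
From mathcomp Require Import all_classical all_reals.
From mathcomp Require Import topology borel_hierarchy.

Set Implicit Arguments.
Unset Strict Implicit.
Unset Printing Implicit Defensive.

Local Open Scope classical_set_scope.
Local Open Scope card_scope.

Definition separable_space (T : topologicalType) :=
  exists2 D : set T, countable D & dense D.

Section borel_classes.
Context {T : topologicalType}.
Implicit Type S : set T.

Definition Fsigmadelta S :=
  exists2 F : nat -> set T, (forall i, Fsigma (F i)) & S = \bigcap_i F i.

Definition Fsigmadeltasigma S :=
  exists2 F : nat -> set T, (forall i, Fsigmadelta (F i)) & S = \bigcup_i F i.

Definition Gdeltasigma S :=
  exists2 F : nat -> set T, (forall i, Gdelta (F i)) & S = \bigcup_i F i.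

End borel_classes.

(* [difference_class m Gamma] is D_{2m}(Gamma): only the values
   A 1, ..., A (2 * m) of the sequence A matter. *)
Definition difference_class {T : Type} (m : nat) (Gamma : set (set T)) :
    set (set T) :=
  [set S | exists A : nat -> set T,
    [/\ forall i, (1 <= i <= 2 * m)%N -> Gamma (A i),
        forall i, (1 <= i < 2 * m)%N -> A i `<=` A i.+1 &
        S = \bigcup_(k in [set k | (1 <= k <= m)%N])
              (A (2 * k)%N `\` A (2 * k).-1)]].

(* The trace of S on the subspace Y, as a subset of the type Y, which carries
   the initial topology of the inclusion. *)
Definition trace {T : Type} (Y S : set T) : set Y := set_val @^-1` S.
Arguments trace {T} Y S.

Definition nonempty_compact (X : topologicalType) : set (set X) :=
  [set A | compact A /\ A !=set0].

Definition hyperspace (X : topologicalType) : Type :=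
  set_type (@nonempty_compact X).

HB.instance Definition _ (X : topologicalType) :=
  Choice.copy (hyperspace X) (set_type (@nonempty_compact X)).

Definition hyperspace_set (X : topologicalType) (A : hyperspace X) : set X :=
  set_val A.

Definition vietoris_hit (X : topologicalType) (U : set X) :
    set (hyperspace X) :=
  [set A | hyperspace_set A `&` U !=set0].

Definition vietoris_sub (X : topologicalType) (U : set X) :
    set (hyperspace X) :=
  [set A | hyperspace_set A `<=` U].

(* Subbase of the Vietoris topology: (true, U) stands for the sets that meet
   the open set U, (false, U) for the sets contained in it. *)
HB.instance Definition _ (X : topologicalType) :=
  isSubBaseTopological.Build (hyperspace X)
    [set i : bool * set X | open i.2]
    (fun i : bool * set X =>
       if i.1 then vietoris_hit i.2 else vietoris_sub i.2).

Section finite_derived_set.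
Context (X : topologicalType).
Implicit Types (n : nat) (E F : set X).

Definition derived (A : hyperspace X) : set X :=
  limit_point (hyperspace_set A).

Definition A_le n : set (hyperspace X) :=
  [set A : hyperspace X | derived A !=set0 /\ derived A #<= `I_n].

Definition A_eq n : set (hyperspace X) :=
  [set A : hyperspace X | derived A #= `I_n].

Definition A_omega : set (hyperspace X) :=
  [set A : hyperspace X | derived A !=set0 /\ finite_set (derived A)].

Definition A_le_pair n E F : set (hyperspace X) :=
  [set A : hyperspace X |
    [/\ A_le n A, hyperspace_set A `\` derived A `<=` E & derived A `<=` F]].

Definition A_eq_pair n E F : set (hyperspace X) :=
  [set A : hyperspace X |
    [/\ A_eq n A, hyperspace_set A `\` derived A `<=` E & derived A `<=` F]].

Definition A_le_in n F : set (hyperspace X) :=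
  [set A : hyperspace X | A_le n A /\ hyperspace_set A `<=` F].

Definition A_eq_in n F : set (hyperspace X) :=
  [set A : hyperspace X | A_eq n A /\ hyperspace_set A `<=` F].

End finite_derived_set.

Arguments A_le X n : clear implicits.
Arguments A_eq X n : clear implicits.
Arguments A_omega X : clear implicits.
Arguments A_le_pair {X} n E F.
Arguments A_eq_pair {X} n E F.
Arguments A_le_in {X} n F.
Arguments A_eq_in {X} n F.

(* Main.v *)
Require Import Defs.
From HB Require Import structures.
From mathcomp Require Import all_boot all_order all_algebra.
From mathcomp Require Import all_classical all_reals interval_inference.
From mathcomp Require Import lra.
From mathcomp Require Import topology num_normedtype borel_hierarchy.

(** For U open, "A meets U in at least N points" is an open condition on A, and
    for A compact every open neighborhood of A' contains all but finitely many
    points of A. Hence A has at least n derived points iff, for some m, for all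
    N there are n open sets at mutual distance at least 1/m, each containing N
    points of A: this is a G_delta_sigma condition, so |A'| <= n is
    F_sigma_delta. Likewise A' is a subset of a closed set C iff A is finite
    outside the closure of each of a sequence of neighborhoods shrinking to C.

    Given a countable basis B and F = U_k G_k with G_k closed:
    - A \ A' is a subset of F iff every B_b either meets A in two points or
      satisfies A /\ B_b <= G_k for some k, which is F_sigma_delta;
    - if |A'| = n, then A' is a subset of F iff there are n basic sets with
      disjoint closures and n indices k_i such that A is infinite inside the
      i-th basic set and arbitrarily close to G_{k_i}, which is G_delta_sigma.
    If R_j denotes the latter set for n = j, then {|A'| = j, A' <= F} equals
    A_j \ (A_{j-1} U (A_j \ R_j)), and these differences for j = 1, ..., n
    are nested. *)

Local Open Scope classical_set_scope.

Set Implicit Arguments.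
Unset Strict Implicit.
Unset Printing Implicit Defensive.

Import Order.TTheory GRing.Theory Num.Theory.
Local Open Scope card_scope.

(** * Finite cardinalities through injections of ordinals *)

Section cardinality.
Context {T : Type}.
Implicit Types (S : set T) (n : nat).

Lemma card_II_leP n S :
  `I_n #<= S <-> exists f : 'I_n -> T, injective f /\ forall i, S (f i).
Proof.
rewrite (card_le_eql card_II); split=> [/card_leP[f]|[f [finj fS]]].
  exists (fun i => set_val (f (to_setT i))); split=> [i j /val_inj|i].
    by move=> /(@inj _ _ _ f); rewrite !inE => /(_ I I)/(congr1 set_val).
  exact: set_mem (valP _).
rewrite -(card_le_eql (@inj_card_eq _ _ setT f _)); last by move=> ? ? _ _ /finj.
by apply: subset_card_le => _ [i _ <-].
Qed.

Lemma infinite_card_II S : infinite_set S <-> forall n, `I_n #<= S.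
Proof.
split=> [/infiniteP NS n|nS /finite_set_leP[n Sn]].
  exact: card_le_trans (subset_card_le (@subsetT _ _)) NS.
by have := card_le_trans (nS n.+1) Sn; rewrite card_le_II ltnn.
Qed.

Lemma not_card_leII n S : ~ (S #<= `I_n) <-> `I_n.+1 #<= S.
Proof.
split=> [Sn|nS Sn]; last first.
  by have := card_le_trans nS Sn; rewrite card_le_II ltnn.
have [/finite_setP[m Sm]|/infinite_card_II//] := pselect (finite_set S).
rewrite (card_le_eqr Sm) card_le_II ltnNge.
by apply/negP; rewrite -card_le_II -(card_le_eql Sm).
Qed.

(** A point [x] of [S] missed by [f] would extend [f] to an injection of [n.+1] indices, with
    [ord_max] sent to [x]. *)
Lemma card_II_surj n S (f : 'I_n -> T) : S #<= `I_n -> injective f ->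
  (forall i, S (f i)) -> forall x, S x -> exists i, f i = x.
Proof.
move=> Sn finj fS x Sx; apply: contrapT => /forallNP fx.
suff /not_card_leII : `I_n.+1 #<= S by [].
apply/card_II_leP; exists (fun i => if unlift ord_max i is Some j then f j else x).
split=> [i j|i]; last by case: unliftP.
case: unliftP => [i' ->|->]; case: unliftP => [j' ->|->] //.
- by move=> /finj->.
- by move=> /fx.
- by move=> /esym/fx.
Qed.

End cardinality.

(** * Limit points of compact sets in Hausdorff spaces *)

Section limit_points.
Context {T : topologicalType}.
Hypothesis hT : hausdorff_space T.
Implicit Types (A U V : set T) (p : T).

(** Finite sets are closed, so if [A] had finitely many points in [U], removing those other than [p]
    would leave a neighborhood of [p]. *)
Lemma limit_point_infinite A U p : limit_point A p -> nbhs p U ->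
  infinite_set (A `&` U).
Proof.
move=> Ap pU fAU.
have : nbhs p (U `&` ~` ((A `&` U) `\ p)).
  apply: filterI => //; apply: open_nbhs_nbhs; split; last by case=> _ /=.
  apply: closed_openC; move: (finite_setD [set p] fAU).
  exact: (accessible_finite_set_closed.1 (hausdorff_accessible hT)).
by move=> /Ap[y [/eqP yp Ay [Uy]]]; apply.
Qed.

(** The sets containing all but finitely many points of [A] form a proper filter; its cluster points
    are limit points of [A]. *)
Lemma compact_limit_point A : compact A -> infinite_set A ->
  limit_point A !=set0.
Proof.
move=> cA iA; pose F : set_system T := [set S | finite_set (A `\` S)].
have FF : ProperFilter F.
  split; first by rewrite /F /= setD0.
  split; rewrite /F /=.
  - by rewrite setDT.
  - by move=> P Q fP fQ; rewrite /= setDIr finite_setU.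
  - by move=> P Q PQ; apply: sub_finite_set => x [Ax nQ]; split => // /PQ.
have FA : F A by rewrite /F /= setDv.
have [p [Ap Fp]] := cA F FF FA; exists p => U pU.
have Fp' : F (A `\ p).
  by apply: sub_finite_set (finite_set1 p) => x [Ax nx]; apply: contrapT => ?; apply: nx.
by have [y [[Ay /eqP yp] Uy]] := Fp _ _ Fp' pU; exists y.
Qed.

Lemma limit_point_subset A B : A `<=` B -> limit_point A `<=` limit_point B.
Proof. by move=> AB p Ap U /Ap[y [yp /AB By Uy]]; exists y. Qed.

(** If infinite, the compact set [A \ V] would have a limit point; this would be a limit point of
    [A] in the closed complement of [V]. *)
Lemma compact_limit_point_sub A V : compact A -> open V ->
  limit_point A `<=` V -> finite_set (A `\` V).
Proof.
move=> cA oV AV; apply: contrapT => iAV.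
have clV : closed (~` V) by exact: open_closedC.
have cAV : compact (A `\` V) by exact: compact_closedI.
have [p pAV] := compact_limit_point cAV iAV.
have : (~` V) p by apply: clV; apply: subset_limit_point (limit_point_subset _ pAV) => x [].
by apply; apply: AV; apply: limit_point_subset pAV => x [].
Qed.

Lemma infinite_limit_point A U : compact A -> infinite_set (A `&` U) ->
  exists p, limit_point A p /\ closure U p.
Proof.
move=> cA iAU; apply: contrapT => /forallNP nAU; apply: iAU.
suff : finite_set (A `\` ~` closure U).
  by apply: sub_finite_set => x [Ax Ux]; split => //; apply; exact: subset_closure.
apply: compact_limit_point_sub => //.
  by apply: closed_openC; exact: closed_closure.
by move=> p Ap Up; apply: (nAU p).
Qed.

Lemma limit_point_compact_sub A : compact A -> limit_point A `<=` A.
Proof.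
move=> /(compact_closed hT) clA p /subset_limit_point; exact: clA.
Qed.

End limit_points.

(** * Closure properties of the low Borel classes *)

Section borel_classes.
Context {T : topologicalType}.

(** Allows unions over pairs, sums and finite functions where the Borel classes require [nat];
    numbers that code no index contribute the empty set. *)
Lemma bigcup_countType (J : countType) (F : J -> set T) :
  \bigcup_i F i = \bigcup_k oapp F set0 (unpickle k).
Proof.
apply/seteqP; split=> [x [i _ Fi]|x [k _]].
  by exists (pickle i) => //; rewrite pickleK.
by case: (unpickle k) => //= i Fi; exists i.
Qed.

Lemma bigcap_countType (J : countType) (F : J -> set T) :
  \bigcap_i F i = \bigcap_k oapp F setT (unpickle k).
Proof.
apply/seteqP; split=> [x Fx k _|x Fx i _].
  by case: (unpickle k) => //= i; exact: Fx.
by have := Fx (pickle i) I; rewrite pickleK.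
Qed.

Lemma Fsigma_bigcup (J : countType) (F : J -> set T) :
  (forall i, closed (F i)) -> Fsigma (\bigcup_i F i).
Proof.
move=> cF; exists (fun k => oapp F set0 (unpickle k)).
  by move=> k; case: (unpickle k) => //=; exact: closed0.
exact: bigcup_countType.
Qed.

Lemma Gdelta_bigcap (J : countType) (F : J -> set T) :
  (forall i, open (F i)) -> Gdelta (\bigcap_i F i).
Proof.
move=> oF; exists (fun k => oapp F setT (unpickle k)).
  by move=> k; case: (unpickle k) => //=; exact: openT.
exact: bigcap_countType.
Qed.

Lemma Fsigmadelta_bigcap (J : countType) (F : J -> set T) :
  (forall i, Fsigma (F i)) -> Fsigmadelta (\bigcap_i F i).
Proof.
move=> FF; exists (fun k => oapp F setT (unpickle k)).
  by move=> k; case: (unpickle k) => //=; exact/closed_Fsigma/closedT.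
exact: bigcap_countType.
Qed.

Lemma Gdeltasigma_bigcup (J : countType) (F : J -> set T) :
  (forall i, Gdelta (F i)) -> Gdeltasigma (\bigcup_i F i).
Proof.
move=> GF; exists (fun k => oapp F set0 (unpickle k)).
  by move=> k; case: (unpickle k) => //=; exact/open_Gdelta/open0.
exact: bigcup_countType.
Qed.

Lemma FsigmaU (A B : set T) : Fsigma A -> Fsigma B -> Fsigma (A `|` B).
Proof.
move=> [F cF ->] [G cG ->]; rewrite -bigcupU.
by exists (fun i => F i `|` G i) => // i; exact: closedU.
Qed.

Lemma FsigmadeltaI (A B : set T) :
  Fsigmadelta A -> Fsigmadelta B -> Fsigmadelta (A `&` B).
Proof.
move=> [F FF ->] [G FG ->].
rewrite (_ : _ `&` _ = \bigcap_i (match i with inl i => F i | inr i => G i end)).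
  by apply: Fsigmadelta_bigcap => -[].
apply/seteqP; split=> [x [Fx Gx] [i|i] _|x FGx]; [exact: Fx|exact: Gx|].
by split=> i _; [exact: (FGx (inl i))|exact: (FGx (inr i))].
Qed.

(** Unions distribute over intersections: a point outside [F i] and outside [G j] fails the
    condition at the pair [(i, j)]. *)
Lemma FsigmadeltaU (A B : set T) :
  Fsigmadelta A -> Fsigmadelta B -> Fsigmadelta (A `|` B).
Proof.
move=> [F FF ->] [G FG ->].
rewrite (_ : _ `|` _ = \bigcap_i (F i.1 `|` G i.2)).
  by apply: Fsigmadelta_bigcap => i; exact: FsigmaU.
apply/seteqP; split=> [x [Fx|Gx] i _|x FGx]; [by left; exact: Fx|by right; exact: Gx|].
apply: contrapT => /not_orP[/existsNP[i Fi] /existsNP[j Gj]].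
by case: (FGx (i, j) I) => ?; [apply: Fi|apply: Gj].
Qed.

Lemma GdeltasigmaC (S : set T) : Gdeltasigma S -> Fsigmadelta (~` S).
Proof.
move=> [G GG ->]; rewrite setC_bigcup; exists (fun i => ~` G i) => // i.
have [U oU ->] := GG i; rewrite setC_bigcap; exists (fun j => ~` U j) => // j.
exact: open_closedC.
Qed.

End borel_classes.

(** * Borel classes in subspaces, and chains of differences *)

Section trace.
Context {T : topologicalType} (Y : set T).

Lemma open_trace (S : set T) : open S -> open (trace Y S).
Proof. by exists S. Qed.

Lemma closed_trace (S : set T) : closed S -> closed (trace Y S).
Proof. by rewrite -!openC; exact: open_trace. Qed.

Lemma Fsigmadelta_trace (S : set T) : Fsigmadelta S -> Fsigmadelta (trace Y S).
Proof.
move=> [F FF ->]; rewrite /trace preimage_bigcap.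
exists (fun i => trace Y (F i)) => // i; have [G cG ->] := FF i.
rewrite /trace preimage_bigcup; exists (fun i => trace Y (G i)) => // j.
exact: closed_trace.
Qed.

Lemma Gdeltasigma_trace (S : set T) : Gdeltasigma S -> Gdeltasigma (trace Y S).
Proof.
move=> [F FF ->]; rewrite /trace preimage_bigcup.
exists (fun i => trace Y (F i)) => // i; have [G cG ->] := FF i.
rewrite /trace preimage_bigcap; exists (fun i => trace Y (G i)) => // j.
exact: open_trace.
Qed.

End trace.

(** The two sequences are interleaved: [Q k] is placed at index [2k - 1] and [P k] at index [2k]. *)
Lemma difference_class_chain {T : Type} (Gamma : set (set T)) (n : nat)
    (P Q : nat -> set T) :
  (forall k, Gamma (P k)) -> (forall k, Gamma (Q k)) ->
  (forall k, Q k `<=` P k) -> (forall k, P k `<=` Q k.+1) ->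
  difference_class n Gamma
    (\bigcup_(k in [set k | (1 <= k <= n)%N]) (P k `\` Q k)).
Proof.
move=> GP GQ QP PQ; exists (fun i => if odd i then Q i./2.+1 else P i./2).
split=> [i _|i _|]; first by case: ifP.
  rewrite /= uphalf_half; case: (odd i) => /=; last exact: PQ.
  by rewrite add1n; exact: QP.
apply: eq_bigcupr => -[//|k] _.
by rewrite mul2n doubleS /= !odd_double/= !uphalf_double doubleK.
Qed.

(** * Basic open and closed sets of the Vietoris topology *)

Section vietoris.
Context {X : topologicalType}.
Implicit Types (U C : set X) (A : hyperspace X).

Lemma hyperspace_compact A : compact (hyperspace_set A).
Proof. by have /set_mem[] := valP A. Qed.

Lemma open_vietoris (i : bool * set X) : open i.2 ->
  open (if i.1 then vietoris_hit i.2 else vietoris_sub i.2).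
Proof.
move=> oi; set b := if _ then _ else _.
exists [set b]; last by rewrite bigcup_set1.
move=> _ ->; exists (finmap.fset1 i); last by rewrite set_fset1 bigcap_set1.
by move=> j; rewrite finmap.inE => /eqP ->; rewrite inE.
Qed.

Lemma open_vietoris_hit U : open U -> open (vietoris_hit U).
Proof. by move=> oU; exact: (@open_vietoris (true, U)). Qed.

Lemma open_vietoris_sub U : open U -> open (vietoris_sub U).
Proof. by move=> oU; exact: (@open_vietoris (false, U)). Qed.

Lemma setC_vietoris_hit U : ~` vietoris_hit U = vietoris_sub (~` U).
Proof.
apply/seteqP; split=> [A nU x Ax Ux|A AU [x [/AU]]//].
by apply: nU; exists x.
Qed.

Lemma closed_vietoris_hit C : closed C -> closed (vietoris_hit C).
Proof.
by rewrite -!openC setC_vietoris_hit; exact: open_vietoris_sub.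
Qed.

Lemma closed_vietoris_sub C : closed C -> closed (vietoris_sub C).
Proof.
move=> cC; rewrite -[C]setCK -setC_vietoris_hit; apply: open_closedC.
by apply: open_vietoris_hit; exact: closed_openC.
Qed.

End vietoris.

Arguments hyperspace_compact {X} A.

(** * Counting points and derived points in metric spaces *)

Section metric.
Context {R : realType} {X : metricType R}.
Implicit Types (U C : set X) (x y : X).

Local Notation rad m := (m.+1%:R^-1 : R)%R.

Lemma radius_gt0 m : (0 < rad m)%R. Proof. by rewrite invr_gt0. Qed.

Lemma near_radius (e : R) : (0 < e)%R -> \forall m \near \oo, (rad m < e)%R.
Proof. by move=> e0; exact: (near_infty_natSinv_lt (PosNum e0)). Qed.

Lemma near_not_ball x y : x != y -> \forall m \near \oo, forall u v,
  ball x (rad m) u -> ball y (rad m) v -> ~ ball u (rad m) v.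
Proof.
move=> xy; near=> m => u v xu yv uv.
have := ball_triangle (ball_triangle xu uv) (ball_sym yv).
rewrite ballEmdist /= => xy3.
(* Three steps of length [rad m] lead from [x] to [y], which is impossible below a third of their
   distance. *)
have : (rad m < mdist x y / 3)%R.
  by near: m; apply: near_radius; rewrite divr_gt0// mdist_gt0.
rewrite ltr_pdivlMr// => /lt_trans/(_ xy3).
by rewrite mulrC mulr_natl 2!mulrSr mulr1n ltxx.
Unshelve. all: by end_near. Qed.

Lemma near_separated n (f : 'I_n -> X) : injective f ->
  \forall m \near \oo, forall i j, i != j -> forall u v,
  ball (f i) (rad m) u -> ball (f j) (rad m) v -> ~ ball u (rad m) v.
Proof.
move=> finj; apply: filter_forall => i; apply: filter_forall => j.
have [->|ij] := eqVneq i j; first exact: nearW.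
have /near_not_ball : f i != f j by apply: contra_neq ij => /finj.
by apply: filterS => m fm _.
Qed.

Lemma ball_interior_center x (e : R) : (0 < e)%R -> (ball x e)° x.
Proof. by move=> e0; exact: (nbhsx_ballx _ _ e0). Qed.

Lemma ball_center_gt0 x (e : R) : (0 < e)%R -> ball x e x.
Proof. by move=> e0; exact: (ball_center x (PosNum e0)). Qed.

(** Distinct points of [A] in [U] have separated small balls; every [B] near [A] still meets each of
    these balls inside [U]. *)
Lemma open_card_ge N U : open U ->
  open [set A : hyperspace X | `I_N #<= hyperspace_set A `&` U].
Proof.
move=> oU; rewrite openE => A /= /card_II_leP[f [finj fAU]].
have [m] := filter_ex (near_separated finj).
pose V i := U `&` (ball (f i) (rad m))° => mf.
have : \forall B \near A, forall i, vietoris_hit (V i) B.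
  apply: (@filter_forall _ _ _ (nbhs A)) => i; apply: open_nbhs_nbhs; split.
    by apply: open_vietoris_hit; apply: openI => //; exact: open_interior.
  exists (f i); have [Afi Ufi] := fAU i; split => //; split => //.
  by exact/ball_interior_center/radius_gt0.
apply: filterS => B /choice[g gV]; apply/card_II_leP; exists g; split; last first.
  by move=> i; have [? []] := gV i.
move=> i j gij; apply: contrapT => /eqP ij.
have [_ [_ /interior_subset gi]] := gV i; have [_ [_ /interior_subset gj]] := gV j.
apply: (mf _ _ ij _ _ gi gj); rewrite gij.
exact/ball_center_gt0/radius_gt0.
Qed.

Lemma closed_card_lt N U : open U ->
  closed [set A : hyperspace X | ~ (`I_N #<= hyperspace_set A `&` U)].
Proof. by move=> oU; apply: open_closedC; exact: open_card_ge. Qed.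

Lemma derived_card_ge n (A : hyperspace X) : `I_n #<= derived A <->
  exists m, forall N, exists U : 'I_n -> set X,
  [/\ forall i, open (U i),
      forall i j, i != j -> forall u v, U i u -> U j v -> ~ ball u (rad m) v &
      forall i, `I_N #<= hyperspace_set A `&` U i].
Proof.
have hX := @metric_hausdorff _ X; have cA := hyperspace_compact A.
split=> [/card_II_leP[f [finj fA]]|[m mA]].
  have [m mf] := filter_ex (near_separated finj).
  exists m => N; exists (fun i => (ball (f i) (rad m))°); split=> [i|i j ij u v|i].
  - exact: open_interior.
  - by move=> /interior_subset ui /interior_subset vj; exact: (mf _ _ ij).
  - apply: (infinite_card_II _).1; apply: limit_point_infinite (fA i) _ => //.
    by apply: nbhs_interior; exact/ball_interior_center/radius_gt0.
(* Pigeonhole: separated sets cannot reach the same ball of radius 1/2m. *)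
pose V := \bigcup_(p in derived A) (ball p (rad m / 2))°.
have r2 : (0 < rad m / 2)%R by rewrite divr_gt0// radius_gt0.
have : finite_set (hyperspace_set A `\` V).
  apply: compact_limit_point_sub => //.
    by apply: bigcup_open => p _; exact: open_interior.
  by move=> p Ap; exists p => //; exact: ball_interior_center.
(* At most [N] points of [A] lie outside [V], so [N.+1] points in [U i] force one of them into
   [V]. *)
move=> /finite_set_leP[N AVN]; have [U [oU sU AU]] := mA N.+1.
have UV i : exists u, U i u /\ exists p, derived A p /\ ball p (rad m / 2) u.
  apply: contrapT => nUV; have := card_le_trans (AU i) (card_le_trans _ AVN).
  rewrite card_le_II ltnn => H; apply/notF/H/subset_card_le => u [Au Uu].
  split => // -[p Ap /interior_subset pu]; apply: nUV; exists u; split => //.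
  by exists p.
have [u /all_and2[Uu /choice[p /all_and2[Ap pu]]]] := choice UV.
apply/card_II_leP; exists p; split => // i j pij; apply: contrapT => /eqP ij.
apply: (sU _ _ ij _ _ (Uu i) (Uu j)); rewrite (splitr (rad m)).
by apply: ball_triangle (pu j); rewrite -pij; exact: ball_sym.
Qed.

Lemma Fsigmadelta_derived_card_le n :
  Fsigmadelta [set A : hyperspace X | derived A #<= `I_n].
Proof.
pose W m N := [set A : hyperspace X | exists U : 'I_n.+1 -> set X,
  [/\ forall i, open (U i),
      forall i j, i != j -> forall u v, U i u -> U j v -> ~ ball u (rad m) v &
      forall i, `I_N #<= hyperspace_set A `&` U i]].
rewrite (_ : mkset _ = \bigcap_m \bigcup_N ~` W m N); last first.
  apply/seteqP; split=> [A /= An m _|A mA /=]; apply: contrapT.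
    move=> nW; apply: (not_card_leII _ _).2 An; apply/derived_card_ge; exists m => N.
    by apply: contrapT => ?; apply: nW; exists N.
  move=> /not_card_leII/derived_card_ge[m /= mW].
  by have [N _ []] := mA m I; exact: mW.
apply: Fsigmadelta_bigcap => m; apply: Fsigma_bigcup => N; apply: open_closedC.
rewrite openE => A [U [oU sU AU]].
(* The family [U] chosen for [A] also serves every nearby [B], because only finitely many open
   conditions are involved. *)
have : \forall B \near A, forall i, `I_N #<= hyperspace_set B `&` U i.
  apply: (@filter_forall _ _ _ (nbhs A)) => i; apply: open_nbhs_nbhs; split; last exact: AU.
  exact: open_card_ge.
by apply: filterS => B BU; exists U.
Qed.

Lemma derived_nonempty (A : hyperspace X) :
  derived A !=set0 <-> infinite_set (hyperspace_set A).
Proof.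
split=> [[p Ap]|]; last exact/compact_limit_point/hyperspace_compact.
by rewrite -(setIT (hyperspace_set A)); apply: limit_point_infinite Ap _;
  [exact: (@metric_hausdorff R)|exact: filterT].
Qed.

Lemma Fsigmadelta_derived_nonempty :
  Fsigmadelta [set A : hyperspace X | derived A !=set0].
Proof.
(* Covering a set by k small sets bounds the number of separated points in it,
   and, unlike the latter, is visibly an open condition. *)
pose small m V := open V /\ forall u v : X, V u -> V v -> ball u (rad m) v.
pose W k m := \bigcup_(c in [set c : set (set X) | c #<= `I_k /\ c `<=` small m])
  vietoris_sub (\bigcup_(V in c) V).
rewrite (_ : mkset _ = \bigcap_k \bigcup_m ~` W k m); last first.
  apply/seteqP; split=> [A /derived_nonempty/infinite_card_II iA k _|A kA /=].
    (* Among [k.+1] points covered by [k] sets, two share a set; for [m] large enough this set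
       cannot be small at scale [rad m]. *)
    have /card_II_leP[f [finj fA]] := iA k.+1.
    have [m mf] := filter_ex (near_separated finj).
    exists m => // -[c [ck csmall] Ac].
    have /choice[g /all_and2[cg gf]] : forall i, exists V, c V /\ V (f i).
      by move=> i; have [V cV Vf] := Ac _ (fA i); exists V.
    apply: (not_card_leII _ _).2 ck; apply/card_II_leP; exists g; split => // i j gij.
    apply: contrapT => /eqP ij; have f0 l : ball (f l) (rad m) (f l).
      exact/ball_center_gt0/radius_gt0.
    apply: (mf _ _ ij _ _ (f0 i) (f0 j)); apply: (csmall _ (cg i)).2 => //.
    by rewrite gij.
  apply/derived_nonempty => /finite_set_leP[k Ak].
  have [m _] := kA k I; apply.
  (* A set of at most [k] points is covered by at most [k] balls around them; half the radius makes
     these balls small. *)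
  exists [set (ball x (rad m / 2))° | x in hyperspace_set A]; last first.
    move=> x Ax; exists (ball x (rad m / 2))°; first by exists x.
    by apply: ball_interior_center; rewrite divr_gt0// radius_gt0.
  split; first exact: card_le_trans (card_image_le _ _) Ak.
  move=> _ [x _ <-]; split; first exact: open_interior.
  move=> u v /interior_subset xu /interior_subset xv; rewrite (splitr (rad m)).
  by apply: ball_triangle xv; exact: ball_sym.
apply: Fsigmadelta_bigcap => k; apply: Fsigma_bigcup => m; apply: open_closedC.
apply: bigcup_open => c [_ cs]; apply: open_vietoris_sub; apply: bigcup_open.
by move=> V /cs[].
Qed.

Lemma Fsigmadelta_A_le n : Fsigmadelta (A_le X n).
Proof.
exact: FsigmadeltaI Fsigmadelta_derived_nonempty (Fsigmadelta_derived_card_le n).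
Qed.

End metric.

(** * Neighborhoods of closed sets, countable bases, and inclusion conditions *)

Section shrinking_neighborhoods.
Context {R : realType} {X : metricType R}.
Implicit Types (C F : set X) (A : hyperspace X).

Local Notation rad m := (m.+1%:R^-1 : R)%R.

(** Take the unions of the balls of radius [rad m] around points of [C]; a point in all the closures
    is arbitrarily close to [C]. *)
Lemma closed_shrinking_nbhs C : closed C -> exists O : nat -> set X,
  [/\ forall m, open (O m), forall m, C `<=` O m & \bigcap_m closure (O m) `<=` C].
Proof.
move=> cC; exists (fun m => \bigcup_(x in C) (ball x (rad m))°); split.
- by move=> m; apply: bigcup_open => x _; exact: open_interior.
- by move=> m x Cx; exists x => //; exact/ball_interior_center/radius_gt0.
move=> p Op; apply: cC => U /nbhs_ballP[e /= e0 peU].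
have e20 : (0 < e / 2)%R by rewrite divr_gt0.
have [m me] := filter_ex (near_radius e20).
have [y [[x Cx /interior_subset xy] py]] := Op m I _ (nbhsx_ballx p _ e20).
exists x; split => //; apply: peU; rewrite (splitr e); apply: ball_triangle py _.
by apply: ball_sym; exact: le_ball (ltW me) _ xy.
Qed.

Lemma separable_basis : separable_space X -> exists B : nat * nat -> set X,
  (forall i, open (B i)) /\
  forall p U, nbhs p U -> exists i, B i p /\ closure (B i) `<=` U.
Proof.
move=> [D /pfcard_geP[->|[e]] dD].
  (* An empty dense set means that [X] has no point. *)
  exists (fun=> set0); split=> [_|p U _]; first exact: open0.
  by have [x []] := dD _ (ex_intro _ p I) openT.
exists (fun i => (ball (e i.1) (rad i.2))°); split=> [i|p U /nbhs_ballP[r /= r0 prU]].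
  exact: open_interior.
have r30 : (0 < r / 3)%R by rewrite divr_gt0.
have [m mr] := filter_ex (near_radius r30).
have m0 := radius_gt0 (R := R) m.
have m20 : (0 < rad m / 2)%R by rewrite divr_gt0.
have [d [/interior_subset pea /(@surj _ _ _ _ e)[a _ ea]]] :=
  dD _ (ex_intro _ p (ball_interior_center p m20)) (open_interior _).
exists (a, m); rewrite /= ea; split.
  apply/nbhs_ballP; exists (rad m / 2)%R => //= q pq; rewrite (splitr (rad m)).
  by apply: ball_triangle pq; exact: ball_sym.
move=> q /(_ _ (nbhsx_ballx q _ m0))[z [/interior_subset az qz]]; apply: prU.
(* The path goes from [p] to the dense point, then to [z] in the ball, then to [q]; its length is
   below [3 * rad m < r]. *)
have : ball p (rad m / 2 + rad m + rad m)%R q.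
  exact: ball_triangle (ball_triangle pea az) (ball_sym qz).
apply: le_ball; have : (rad m * 3 < r)%R by rewrite -ltr_pdivlMr.
by move: m.+1%:R^-1%R m0 => t; lra.
Qed.

(** Removing the closure of [O m], not just [O m], leaves an open set, in which a limit point forces
    infinitely many points of [A]. *)
Lemma derived_sub_closedP C (O : nat -> set X) A :
  (forall m, open (O m)) -> (forall m, C `<=` O m) ->
  \bigcap_m closure (O m) `<=` C ->
  derived A `<=` C <->
  forall m, finite_set (hyperspace_set A `&` ~` closure (O m)).
Proof.
move=> oO CO OC; split=> [AC m|fA p Ap].
  have : finite_set (hyperspace_set A `\` O m).
    apply: compact_limit_point_sub => //; first exact: hyperspace_compact.
    exact: subset_trans AC (CO m).
  by apply: sub_finite_set => x [Ax nx]; split => // Ox; apply/nx/subset_closure.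
apply: OC => m _; apply: contrapT => nOp.
apply: (limit_point_infinite (metric_hausdorff (T := X)) Ap _ (fA m)).
apply: open_nbhs_nbhs; split => //.
by apply: closed_openC; exact: closed_closure.
Qed.

Lemma Fsigmadelta_derived_sub_closed C : closed C ->
  Fsigmadelta [set A : hyperspace X | derived A `<=` C].
Proof.
move=> /closed_shrinking_nbhs[O [oO CO OC]].
rewrite (_ : mkset _ = \bigcap_m \bigcup_N
    [set A | ~ (`I_N #<= hyperspace_set A `&` ~` closure (O m))]); last first.
  apply/seteqP; split=> [A /= /(derived_sub_closedP _ oO CO OC) fA m _|A fA /=].
    have := fA m; apply: contraPP => /= nA; apply/infinite_card_II => N.
    by apply: contrapT => ?; apply: nA; exists N.
  apply/(derived_sub_closedP _ oO CO OC) => m; have [N _] := fA m I.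
  by apply: contra_notP => /infinite_card_II.
apply: Fsigmadelta_bigcap => m; apply: Fsigma_bigcup => N; apply: closed_card_lt.
by apply: closed_openC; exact: closed_closure.
Qed.

Lemma Fsigmadelta_isolated_sub F : separable_space X -> Fsigma F ->
  Fsigmadelta [set A : hyperspace X | hyperspace_set A `\` derived A `<=` F].
Proof.
move=> /separable_basis[B [oB basisB]] [G cG ->{F}].
(* [two_points b c d] makes "A meets B b in two points" a countable union of
   closed conditions. *)
pose two_points b c d := [/\ closure (B c) `<=` B b, closure (B d) `<=` B b &
  closure (B c) `&` closure (B d) = set0].
pose W b (j : ((nat * nat) * (nat * nat) + nat)%type) : set (hyperspace X) :=
  match j with
  | inl (c, d) => [set A | two_points b c d /\
      (vietoris_hit (closure (B c)) `&` vietoris_hit (closure (B d))) A]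
  | inr k => vietoris_sub (~` B b `|` G k)
  end.
have hX := @metric_hausdorff _ X.
rewrite (_ : mkset _ = \bigcap_b \bigcup_j W b j).
  (* [two_points] does not depend on [A], so each [W b j] is either empty or given by the closed
     conditions alone. *)
  apply: Fsigmadelta_bigcap => b; apply: Fsigma_bigcup => -[[c d]|k] /=.
    have [bcd|nbcd] := pselect (two_points b c d).
      rewrite (_ : mkset _ =
        vietoris_hit (closure (B c)) `&` vietoris_hit (closure (B d))).
        by apply: closedI; apply: closed_vietoris_hit; exact: closed_closure.
      by apply/seteqP; split=> A [].
    by rewrite (_ : mkset _ = set0) ?set0P//; [exact: closed0|apply/seteqP; split=> A []].
  by apply: closed_vietoris_sub; apply: closedU => //; exact: open_closedC.
apply/seteqP; split=> [A /= AG b _|A AW p [Ap nAp]].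
  have [[x [y [xy [Ax bx] [Ay By]]]]|nxy] := pselect (exists x y, [/\ x <> y,
      (hyperspace_set A `&` B b) x & (hyperspace_set A `&` B b) y]).
    move: hX; rewrite open_hausdorff => /(_ x y)[|[U V] /=]; first exact/eqP.
    move=> [/set_mem Ux /set_mem Vy] [oU oV UV].
    have [c [cx cU]] : exists c, B c x /\ closure (B c) `<=` U `&` B b.
      by apply: basisB; apply: open_nbhs_nbhs; split => //; exact: openI.
    have [d [dy dV]] : exists d, B d y /\ closure (B d) `<=` V `&` B b.
      by apply: basisB; apply: open_nbhs_nbhs; split => //; exact: openI.
    exists (inl (c, d)) => //; split; last first.
      by split; [exists x|exists y]; split => //; exact: subset_closure.
    split; [by move=> z /cU[]|by move=> z /dV[]|].
    apply/seteqP; split=> // z [/cU[Uz _] /dV[Vz _]].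
    by move/eqP : UV => <-.
  (* A single point of [A] in [B b] is isolated, hence lies in some [G k]; if there is none, any [k]
     will do. *)
  have [[x [Ax bx]]|nx] := pselect (hyperspace_set A `&` B b !=set0).
    have AB z : hyperspace_set A z -> B b z -> z = x.
      by move=> Az bz; apply: contrapT => zx; apply: nxy; exists z, x.
    have [k _ Gx] : (\bigcup_k G k) x.
      apply: AG; split => // /(_ (B b))[|y [/eqP yx Ay By]]; last exact/yx/AB.
      exact: open_nbhs_nbhs.
    exists (inr k) => // z Az; have [bz|] := pselect (B b z); last by left.
    by right; rewrite (AB z).
  exists (inr 0%N) => // z Az; left => bz; apply: nx; by exists z.
(* A basic set meeting [A] only in the isolated point [p] rules out the two-point alternative. *)
have : exists2 U, nbhs p U & hyperspace_set A `&` U `<=` [set p].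
  by rewrite -not_limit_pointE.
move=> [U pU AU]; have [b [bp bU]] := basisB _ _ pU.
have [[[c d]|k] _ /=] := AW b I.
  move=> [[cb db cd] [[x [Ax cx]] [y [Ay dy]]]].
  have Ex z : hyperspace_set A z -> B b z -> z = p.
    by move=> Az bz; apply: AU; split => //; apply: bU; exact: subset_closure.
  have xp := Ex _ Ax (cb _ cx); have yp := Ex _ Ay (db _ dy).
  suff : set0 p by []; rewrite -cd; split; first by rewrite -xp.
  by rewrite -yp.
by move=> /(_ p Ap)[//|Gp]; exists k.
Qed.

End shrinking_neighborhoods.

(** * Hyperspaces of sets with finite derived set *)

Section finite_derived_set.
Context {R : realType} {X : metricType R}.
Implicit Types (E F : set X) (A : hyperspace X) (n : nat).

Lemma A_eqE n A : A_eq X n A <-> `I_n #<= derived A /\ derived A #<= `I_n.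
Proof. by rewrite /A_eq /= card_eq_le andbC; split=> /andP. Qed.

(** [S] lives in the whole hyperspace, so that it can be traced on [A_eq X n] and also enter the
    difference chains. *)
Lemma Gdeltasigma_derived_sub n F : separable_space X -> Fsigma F ->
  exists2 S : set (hyperspace X), Gdeltasigma S &
    forall A, A_eq X n A -> S A <-> derived A `<=` F.
Proof.
move=> /separable_basis[B [oB basisB]] [G cG ->{F}].
have /choice[O /all_and3[oO GO OG]] := fun k => closed_shrinking_nbhs (cG k).
(* Finite functions form a [countType], as the union over [uk] requires. *)
pose disj (u : {ffun 'I_n -> nat * nat}) :=
  forall i j, i != j -> closure (B (u i)) `&` closure (B (u j)) = set0.
pose W (uk : {ffun 'I_n -> nat * nat} * {ffun 'I_n -> nat})
    (imN : 'I_n * nat * nat) := [set A : hyperspace X | disj uk.1 /\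
  `I_(imN.2) #<= hyperspace_set A `&`
     (B (uk.1 imN.1.1) `&` O (uk.2 imN.1.1) imN.1.2)].
have WP uk A : (\bigcap_t W uk t) A -> disj uk.1 -> forall i m,
    exists p, [/\ derived A p, closure (B (uk.1 i)) p & closure (O (uk.2 i) m) p].
  move=> AW _ i m.
  have [|p [Ap BOp]] := @infinite_limit_point _ (hyperspace_set A)
      (B (uk.1 i) `&` O (uk.2 i) m) (hyperspace_compact A).
    by apply/infinite_card_II => N; exact: (AW (i, m, N) I).2.
  by exists p; have [] := closureI BOp.
have hX := @metric_hausdorff _ X.
exists (\bigcup_uk \bigcap_t W uk t).
  apply: Gdeltasigma_bigcup => uk; apply: Gdelta_bigcap => -[[i m] N].
  have [du|ndu] := pselect (disj uk.1); last first.
    by rewrite (_ : W _ _ = set0); [exact: open0|apply/seteqP; split=> A []].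
  rewrite (_ : W _ _ = [set A | `I_N #<= hyperspace_set A `&`
      (B (uk.1 i) `&` O (uk.2 i) m)]); last by apply/seteqP; split=> A //= [].
  by apply: open_card_ge; exact: openI.
move=> A /A_eqE[nA An]; split=> [[uk _ AW] p Ap|AF].
  (* [disj] is read off some [W uk t], whose index [t] contains an element of ['I_n]. *)
  have [n0|n_gt0] := posnP n.
    by move: An; rewrite n0 II0 => /card_le0P A0; move: Ap; rewrite A0.
  have du : disj uk.1 by have [] := AW (Ordinal n_gt0, 0%N, 0%N) I.
  have /choice[g0 g0P] := fun mi => WP _ _ AW du mi.2 mi.1.
  pose g m i := g0 (m, i).
  have gP m i : [/\ derived A (g m i), closure (B (uk.1 i)) (g m i) &
      closure (O (uk.2 i) m) (g m i)] by exact: (g0P (m, i)).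
  (* The points [g m i] lie in disjoint closures, so these [n] distinct derived points exhaust
     [derived A]. *)
  have hit m : exists i, g m i = p.
    apply: card_II_surj An _ (fun i => let: And3 Ai _ _ := gP m i in Ai) _ Ap.
    move=> i j gij; apply: contrapT => /eqP /du ij.
    have [_ Bi _] := gP m i; have [_ Bj _] := gP m j.
    by suff : set0 (g m i) by []; rewrite -ij; split => //; rewrite gij.
  (* The index hitting [p] is the same for all [m], since [p] lies in only one of the disjoint
     closures. *)
  have [i ip] := hit 0%N; exists (uk.2 i) => //; apply: OG => m _.
  have [j jp] := hit m; have [_ _] := gP m j.
  rewrite jp; suff -> : i = j by [].
  apply: contrapT => /eqP /du ij.
  have [_ Bi _] := gP 0%N i; have [_ Bj _] := gP m j.
  by suff : set0 p by []; rewrite -ij; split; [rewrite -ip|rewrite -jp].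
have [f [finj fA]] := (card_II_leP _ _).1 nA.
have /choice[k fG] : forall i, exists k, G k (f i).
  by move=> i; have [k _ Gk] := AF _ (fA i); exists k.
have [m mf] := filter_ex (near_separated finj).
have /choice[u /all_and2[uf uB]] : forall i, exists b,
    B b (f i) /\ closure (B b) `<=` (ball (f i) m.+1%:R^-1%R)°.
  by move=> i; apply: basisB; apply: nbhs_interior; exact: nbhsx_ballx.
exists ([ffun i => u i], [ffun i => k i]) => // -[[i l] N] _; split=> /=.
  move=> i1 i2 i12; rewrite !ffunE; apply/seteqP; split=> // x [x1 x2].
  have f1 := interior_subset (uB _ _ x1); have f2 := interior_subset (uB _ _ x2).
  apply: (mf _ _ i12 _ _ f1 f2); apply: ball_center_gt0; exact: radius_gt0.
apply: (infinite_card_II _).1; apply: limit_point_infinite (fA i) _ => //.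
rewrite !ffunE; apply: open_nbhs_nbhs; split; first exact: openI.
by split => //; apply: GO.
Qed.

Lemma A_le_card n A : A_le X n A -> exists2 j, (1 <= j <= n)%N & A_eq X j A.
Proof.
move=> [A0 An]; have /finite_setP[j Aj] : finite_set (derived A).
  by apply/finite_set_leP; exists n.
exists j => //; apply/andP; split; last by rewrite -card_le_II -(card_le_eql Aj).
rewrite lt0n; apply/eqP => j0; move: Aj A0; rewrite j0 II0 card_eq0 => /eqP->.
by case.
Qed.

Lemma A_le_eq n A : (0 < n)%N -> A_eq X n A -> A_le X n A.
Proof.
move=> n0 /A_eqE[nA An]; split => //.
by have /card_II_leP[f [_ fA]] := nA; exists (f (Ordinal n0)).
Qed.

Lemma A_le_mono m n A : (m <= n)%N -> A_le X m A -> A_le X n A.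
Proof.
by move=> mn [A0 Am]; split => //; apply: card_le_trans Am _; rewrite card_le_II.
Qed.

(** Choosing [E] or [F] to be the whole space yields all three cases; intersecting every term with
    [J] preserves the nesting. *)
Lemma difference_class_A_le_pair n E F : separable_space X ->
  Fsigma E -> Fsigma F -> difference_class n Fsigmadelta (A_le_pair n E F).
Proof.
move=> sX sE sF; pose J := [set A : hyperspace X | hyperspace_set A `\` derived A `<=` E].
have /choice[S /all_and2[GS SF]] : forall j, exists S : set (hyperspace X),
    Gdeltasigma S /\ forall A, A_eq X j A -> S A <-> derived A `<=` F.
  by move=> j; have [S] := Gdeltasigma_derived_sub j sX sF; exists S.
pose P j := A_le X j `&` J.
(* Removing [A_le X j.-1] leaves exactly [j] derived points, the only case where [S j] is
   meaningful; for [j = 1] that set is empty. *)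
pose Q j := (A_le X j.-1 `|` (A_le X j `&` ~` S j)) `&` J.
have FJ : Fsigmadelta J by exact: Fsigmadelta_isolated_sub.
rewrite (_ : A_le_pair n E F =
    \bigcup_(j in [set j | (1 <= j <= n)%N]) (P j `\` Q j)).
  apply: difference_class_chain => j.
  - by apply: FsigmadeltaI => //; exact: Fsigmadelta_A_le.
  - apply: FsigmadeltaI => //; apply: FsigmadeltaU; first exact: Fsigmadelta_A_le.
    by apply: FsigmadeltaI (Fsigmadelta_A_le _) _; exact: GdeltasigmaC.
  - by move=> A [[/(A_le_mono (leq_pred j)) Aj|[Aj _]] JA].
  - by move=> A [Aj JA]; split => //; left.
apply/seteqP; split=> [A [/A_le_card[j jn Aj] JA AF]|A [j /= /andP[j0 jn]]].
  have j0 : (0 < j)%N by case/andP: jn.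
  exists j => //; split; first by split => //; exact: A_le_eq.
  move=> [[[_ Aj1]|[_ nS]] _]; last by apply/nS/SF.
  have /A_eqE[jA _] := Aj; have := card_le_trans jA Aj1.
  by rewrite card_le_II; case: (j) j0 => // k _; rewrite ltnn.
move=> [[Aj JA] nQ]; have [A0 Aj'] := Aj; split => //.
  exact: A_le_mono jn Aj.
have jA : A_eq X j A.
  apply/A_eqE; split => //; case: (j) j0 Aj' Aj nQ => // k _ _ _ nQ.
  by apply/not_card_leII => Ak; apply: nQ; split => //; left.
apply/(SF j A jA); apply: contrapT => nS; apply: nQ; split => //; right.
by split.
Qed.

(** Compact sets are closed here, hence contain their limit points. *)
Lemma hyperspace_subE F A : hyperspace_set A `<=` F <->
  hyperspace_set A `\` derived A `<=` F /\ derived A `<=` F.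
Proof.
have := limit_point_compact_sub (@metric_hausdorff _ X) (hyperspace_compact A).
move=> A'A; split=> [AF|[AF A'F] x Ax].
  by split; [exact: subset_trans (@subDsetl _ _ _) AF|exact: subset_trans A'A AF].
by have [/A'F//|nx] := pselect (derived A x); exact: AF.
Qed.

Lemma A_le_inE n F : A_le_in n F = A_le_pair n F F.
Proof.
apply/seteqP; split=> [A [An /hyperspace_subE[]]//|A [An AF A'F]].
by split => //; apply/hyperspace_subE.
Qed.

Lemma A_eq_inE n F : A_eq_in n F = A_eq_pair n F F.
Proof.
apply/seteqP; split=> [A [An /hyperspace_subE[]]//|A [An AF A'F]].
by split => //; apply/hyperspace_subE.
Qed.

Lemma Fsigmadelta_trace_A_eq_pair n E : separable_space X -> Fsigma E ->
  Fsigmadelta (trace (A_eq X n) (A_eq_pair n E [set: X])).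
Proof.
move=> sX sE; rewrite (_ : trace _ _ = trace (A_eq X n)
    [set A | hyperspace_set A `\` derived A `<=` E]).
  by apply: Fsigmadelta_trace; exact: Fsigmadelta_isolated_sub.
apply/seteqP; split=> [A []//|A AE]; split => //; exact: set_mem (valP A).
Qed.

Lemma Gdeltasigma_trace_A_eq_pair n F : separable_space X -> Fsigma F ->
  Gdeltasigma (trace (A_eq X n) (A_eq_pair n [set: X] F)).
Proof.
move=> sX sF; have [S GS SF] := Gdeltasigma_derived_sub n sX sF.
rewrite (_ : trace _ _ = trace (A_eq X n) S); first exact: Gdeltasigma_trace.
have nA (A : A_eq X n) : A_eq X n (set_val A) by exact: set_mem (valP A).
apply/seteqP; split=> [A [_ _ /(SF _ (nA A))]//|A /(SF _ (nA A)) AF].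
by split => //; exact: nA.
Qed.

(** The trace is the intersection of [P] and [Q], that is [P \ (P \ Q)], and the complement of [Q]
    is F_sigma_delta. *)
Lemma difference_class_A_eq_pair n E F : separable_space X ->
  Fsigma E -> Fsigma F ->
  difference_class 1 Fsigmadelta (trace (A_eq X n) (A_eq_pair n E F)).
Proof.
move=> sX sE sF.
pose P := trace (A_eq X n) (A_eq_pair n E [set: X]).
pose Q := trace (A_eq X n) (A_eq_pair n [set: X] F).
have FP : Fsigmadelta P by exact: Fsigmadelta_trace_A_eq_pair.
have FQ : Fsigmadelta (~` Q) by exact/GdeltasigmaC/Gdeltasigma_trace_A_eq_pair.
exists (fun i => if i == 1%N then P `&` ~` Q else P); split=> [i _|[|[|i]]//= _ x []//|].
  by case: ifP => // _; exact: FsigmadeltaI.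
rewrite (_ : [set k | _] = [set 1%N]); last first.
  by apply/seteqP; split=> k /=; [case: k => [|[|]]|move->].
rewrite bigcup_set1 /=; apply/seteqP; split=> [A [An AE AF]|A [[An AE _] nQ]].
  by split=> // -[_]; apply.
by have [_ _ AF] : Q A by apply: contrapT => nA; apply: nQ; split.
Qed.

Lemma A_omegaE : A_omega X = \bigcup_n A_le X n.
Proof.
apply/seteqP; split=> [A [A0 /finite_set_leP[n An]]|A [n _ [A0 An]]].
  by exists n.
by split => //; apply/finite_set_leP; exists n.
Qed.

Lemma Fsigmadelta_A_le_pair_closed n F : closed F ->
  Fsigmadelta (A_le_pair n [set: X] F).
Proof.
move=> cF; rewrite (_ : A_le_pair _ _ _ = A_le X n `&` [set A | derived A `<=` F]).
  by apply: FsigmadeltaI (Fsigmadelta_A_le _) _; exact: Fsigmadelta_derived_sub_closed.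
by apply/seteqP; split=> A [].
Qed.

End finite_derived_set.

Theorem theorem2p1 (R : realType) (X : metricType R) (n : nat) (hn : (0 < n)%N) :
  (Fsigmadelta (A_le X n) /\
   forall F : hyperspace X,
     Fsigmadelta (A_le_pair n [set: X] (hyperspace_set F))) /\
  Fsigmadeltasigma (A_omega X) /\
  (separable_space X -> forall F : set X, Fsigma F ->
     Fsigmadelta (trace (A_eq X n) (A_eq_pair n F [set: X])) /\
     Gdeltasigma (trace (A_eq X n) (A_eq_pair n [set: X] F)) /\
     difference_class 1 Fsigmadelta (trace (A_eq X n) (A_eq_in n F)) /\
     [/\ difference_class n Fsigmadelta (A_le_pair n F [set: X]),
         difference_class n Fsigmadelta (A_le_pair n [set: X] F) &
         difference_class n Fsigmadelta (A_le_in n F)]).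
Proof.
split; [split=> [|F]|split=> [|sX F sF]].
- exact: Fsigmadelta_A_le.
- apply: Fsigmadelta_A_le_pair_closed.
  exact: compact_closed (@metric_hausdorff _ X) (hyperspace_compact F).
- by rewrite A_omegaE; exists (A_le X) => // i; exact: Fsigmadelta_A_le.
have sT : Fsigma [set: X] by exact/closed_Fsigma/closedT.
split; first exact: Fsigmadelta_trace_A_eq_pair.
split; first exact: Gdeltasigma_trace_A_eq_pair.
rewrite A_eq_inE A_le_inE; split; first exact: difference_class_A_eq_pair.
by split; exact: difference_class_A_le_pair.
Qed.
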